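(* Let $d$ be a non-negative integer, $Z$ a finite abelian group, $\mu$ the Haar probability measure on $\mathbb{T}^d\times Z$, and $\alpha$ a real number. Let $A,B$ be closed subsets of $\mathbb{T}^d\times Z$ satisfying $0<\mu(A+B)\leq\alpha\,\mu(A)$. For each positive integer $n$ let $A_n=A+\big([-\tfrac1n,\tfrac1n]^d\times\{0_Z\}\big)$. Then for every $\epsilon>0$, for every sufficiently large $n\in\mathbb{N}$ there exists a non-empty closed subset $A_n'\subset A_n$ such that for every $m\in\mathbb{N}$ we have $\mu(A_n'+mB)\leq (1+\epsilon)^m\alpha^m\mu(A_n')$.
   Context: $\mathbb{T}=\mathbb{R}/\mathbb{Z}$, identified as a set with $[0,1)$ (so $[-\tfrac1n,\tfrac1n]$ denotes its image in $\mathbb{T}$). $mB=\{b_1+\dots+b_m:b_i\in B\}$. *)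

(* Defs.v *)
From HB Require Import structures.
From mathcomp Require Import all_boot all_order all_algebra.
From mathcomp Require Import all_classical all_reals all_analysis.
Set Implicit Arguments. Unset Strict Implicit. Unset Printing Implicit Defensive.
Import Order.TTheory GRing.Theory Num.Theory.
Import numFieldNormedType.Exports.
Local Open Scope classical_set_scope.
Local Open Scope ring_scope.

(* The group T^d x Z, with T = R/Z represented by [0,1) and addition mod 1 *)

Section TorusDefs.
Context {R : realType} {d : nat} {Z : finZmodType}.

Definition fracr (r : R) : R := r - (Num.floor r)%:~R.

Lemma fracr_ge0 r : 0 <= fracr r.
Proof. by rewrite /fracr subr_ge0 floor_le. Qed.

Lemma fracr_lt1 r : fracr r < 1.
Proof. rewrite /fracr ltrBlDl; have := floorD1_gt r; by rewrite intrD1 addrC. Qed.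

Definition in_unit_cube (x : 'rV[R]_d) : bool :=
  [forall i, (0 <= x ord0 i) && (x ord0 i < 1)].

Definition torus := {x : 'rV[R]_d | in_unit_cube x}.

Lemma tproj_proof (x : 'rV[R]_d) : in_unit_cube (map_mx fracr x).
Proof.
by apply/forallP => i; rewrite mxE fracr_ge0 fracr_lt1.
Qed.

Definition tproj (x : 'rV[R]_d) : torus := exist _ (map_mx fracr x) (tproj_proof x).

Definition TZ := (torus * Z)%type.

Definition tzadd (p q : TZ) : TZ :=
  (tproj (proj1_sig p.1 + proj1_sig q.1), (p.2 + q.2)%R).
Definition tzzero : TZ := (tproj 0, 0%R).

Definition sumset (A B : set TZ) : set TZ :=
  [set c | exists a b, A a /\ B b /\ c = tzadd a b].

Fixpoint msumset (m : nat) (B : set TZ) : set TZ :=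
  match m with
  | 0 => [set tzzero]
  | m'.+1 => sumset (msumset m' B) B
  end.

(* closed subsets of T^d x Z (quotient topology on T^d, discrete on Z):
   each fibre has closed preimage in R^d under the quotient map *)
Definition closedTZ (A : set TZ) : Prop :=
  forall z : Z, closed [set x : 'rV[R]_d | A (tproj x, z)].

Definition small_box (n : nat) : set TZ :=
  [set p | exists x : 'rV[R]_d,
      (forall i, `|x ord0 i| <= n%:R^-1) /\ p = (tproj x, 0%R)].

Definition thicken (A : set TZ) (n : nat) : set TZ := sumset A (small_box n).

Definition rbox (a b : 'rV[R]_d) : set 'rV[R]_d :=
  [set x | forall i, a ord0 i <= x ord0 i <= b ord0 i].
Definition rvol (a b : 'rV[R]_d) : R :=
  \prod_(i < d) Num.max 0 (b ord0 i - a ord0 i).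
(* a countable cover is a sequence of optional boxes (None = no box), so that
   the empty family is allowed also when d = 0 *)
Definition obox (o : option ('rV[R]_d * 'rV[R]_d)) : set 'rV[R]_d :=
  if o is Some ab then rbox ab.1 ab.2 else set0.
Definition ovol (o : option ('rV[R]_d * 'rV[R]_d)) : R :=
  if o is Some ab then rvol ab.1 ab.2 else 0.
Definition lebesgue_outer (S : set 'rV[R]_d) : \bar R :=
  ereal_inf [set s : \bar R | exists c : nat -> option ('rV[R]_d * 'rV[R]_d),
      S `<=` \bigcup_k obox (c k) /\
      s = (\sum_(0 <= k <oo) (ovol (c k))%:E)%E].

Definition haar (A : set TZ) : \bar R :=
  ((#|Z|%:R^-1)%:E *
   \sum_(z : Z) lebesgue_outer
      [set x : 'rV[R]_d | in_unit_cube x /\ A (tproj x, z)])%E.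

End TorusDefs.

(* Main.v *)
(* Petridis' form of Pluennecke's inequality gives the statement for finite
   abelian groups, and everything is transferred from the grid
   (1/M)Z^d/Z^d x Z with M = 2n.  Replace A and B by the sets At, Bt of grid
   points at distance at most 1/M.  Since A + B is compact, the thickened set
   At + Bt has density at most (1 + eps) mu(A + B), so that
   |At + Bt| <= (1 + eps) alpha |At|.  If S is the subset of At given by
   Petridis' argument, take for A' the union of the closed mesh cells with
   lower corner in S.  Adding B to a union of cells stays inside the union of
   the cells over S + Bt: overlaps between neighbouring cells are absorbed by Bt
   once and for all, so no boundary factor accumulates as m grows. *)
Require Import Defs.
From HB Require Import structures.
From mathcomp Require Import all_boot all_order all_algebra.
From mathcomp Require Import ring lra zify.
Import Order.TTheory GRing.Theory Num.Theory.
Local Open Scope ring_scope.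
Set Implicit Arguments.
Unset Strict Implicit.

(* Provides the [finZmodType] structure on products of [finZmodType]s. *)
HB.saturate prod.

(** * Petridis' inequality in finite abelian groups *)

Section FinitePluennecke.
Context {G : finZmodType}.
Implicit Types A B C X : {set G}.

Definition addset A B : {set G} := [set x + y | x in A, y in B].

Lemma mem_addset A B x y : x \in A -> y \in B -> x + y \in addset A B.
Proof. exact: imset2_f. Qed.

Lemma addset0 A : addset A set0 = set0.
Proof. by apply/setP => x; rewrite inE; apply/imset2P => -[? ? _]; rewrite inE. Qed.

Lemma addset_zero A : addset A [set 0] = A.
Proof.
by rewrite /addset imset2_set1r -[RHS]imset_id; apply: eq_imset => a; rewrite addr0.
Qed.

Lemma addsetA A B C : addset A (addset B C) = addset (addset A B) C.
Proof.
apply/setP => x; apply/imset2P/imset2P.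
- move=> [a _ aA /imset2P[b c bB cC ->] ->].
  by exists (a + b) c; rewrite ?addrA //; exact: mem_addset.
- move=> [_ c /imset2P[a b aA bB ->] cC ->].
  by exists a (b + c); rewrite ?addrA //; exact: mem_addset.
Qed.

Lemma addsetC A B : addset A B = addset B A.
Proof.
by apply/setP => x; apply/imset2P/imset2P => -[a b aA bB ->];
  exists b a => //; rewrite addrC.
Qed.

Lemma addsetU1 A x C : addset A (x |: C) = addset A C :|: addset A [set x].
Proof.
apply/setP => y; rewrite inE; apply/imset2P/orP.
  by move=> [a b aA]; rewrite in_setU => /orP[bx|bC] ->; [right|left];
    exact: mem_addset.
by move=> [|] /imset2P[a b aA bC ->]; exists a b; rewrite // in_setU bC ?orbT.
Qed.

Lemma card_addset1 A x : #|addset A [set x]| = #|A|.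
Proof. by rewrite /addset imset2_set1r card_imset //; exact: addIr. Qed.

(* Petridis' lemma, by adding the elements [x] of [C] one at a time; [X] is
   the set of those [a] in [A] for which [a + B + x] brings nothing new. *)
Lemma petridis {R : realFieldType} (k : R) A B : 0 <= k ->
    (forall X, X \subset A -> k * #|X|%:R <= #|addset X B|%:R) ->
    #|addset A B|%:R <= k * #|A|%:R ->
  forall C, #|addset (addset A B) C|%:R <= k * #|addset A C|%:R.
Proof.
move=> k0 kmin kA C; have [n] := ubnP #|C|; elim: n => // n IHn in C *.
have [->|[x xC]] := set_0Vmem C; first by rewrite !addset0 cards0 mulr0.
rewrite (cardsD1 x) xC ltnS => /IHn; have := setD1K xC.
set D := C :\ x => <- {xC IHn} IHD.
pose X := [set a in A | addset [set a] (addset B [set x])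
                          \subset addset (addset A B) D].
have XA : X \subset A by apply/subsetP => a; rewrite inE => /andP[].
(* [A + (x |: D)] is the union of [A + D] and [A + x]. If [a + x = a' + c] lies in both, then
   [a + b + x = a' + b + c] lies in [A + B + D] for every [b] in [B], so [a] is in [X]: the
   intersection is inside [X + x]. *)
have cardAD : (#|addset A D| + #|A| <= #|addset A (x |: D)| + #|X|)%N.
  rewrite addsetU1 -(card_addset1 A x) -cardsUI leq_add2l -(card_addset1 X x).
  apply/subset_leq_card/subsetP => y; rewrite inE => /andP[yD].
  rewrite /addset !imset2_set1r => /imsetP[a aA y_ax]; apply/imsetP; exists a => //.
  rewrite inE aA /=; apply/subsetP => _ /imset2P[_ z /set1P-> zBx ->].
  move: zBx => /imset2P[b _ bB /set1P-> ->].
  move: yD => /imset2P[a' c a'A cD ya'c].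
  rewrite (_ : a + (b + x) = a' + b + c) ?mem_addset //.
  by rewrite (addrC b) addrA -y_ax ya'c addrAC.
(* The same decomposition for [A + B]; here the definition of [X] puts [X + B + x] inside the
   intersection. *)
have cardABD : (#|addset (addset A B) (x |: D)| + #|addset X B|
                <= #|addset (addset A B) D| + #|addset A B|)%N.
  rewrite addsetU1 -(card_addset1 (addset A B) x) -[leqRHS]cardsUI leq_add2l.
  rewrite -(card_addset1 (addset X B) x); apply/subset_leq_card.
  rewrite subsetI; apply/andP; split; last exact/imset2Sl/imset2Sl.
  apply/subsetP => y; rewrite -addsetA => /imset2P[a z].
  rewrite inE => /andP[aA /subsetP sub] zBx ->.
  by apply: sub; apply: mem_addset; rewrite ?inE.
have {cardABD}: (#|addset (addset A B) (x |: D)| + #|addset X B|)%:R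
  <= (#|addset (addset A B) D| + #|addset A B|)%:R :> R by rewrite ler_nat.
have {cardAD}: k * (#|addset A D| + #|A|)%:R
  <= k * (#|addset A (x |: D)| + #|X|)%:R :> R by rewrite ler_wpM2l ?ler_nat.
by have := kmin X XA; rewrite !natrD !mulrDr; lra.
Qed.

Definition sumset_iter A B m := iter m (addset^~ B) A.

Lemma sumset_iterE A B m : sumset_iter A B m = addset A (sumset_iter [set 0] B m).
Proof. by elim: m => [|m /= ->]; rewrite ?addset_zero ?addsetA. Qed.

(** [A'] minimises the growth ratio [F X] over the non-empty subsets of [A]; this is the hypothesis
    of [petridis] with [k = F A' <= K]. Taking [C = mB] there shows that each further copy of [B]
    costs one factor [K]. *)
Lemma pluennecke {R : realFieldType} (K : R) A B :
    A != set0 -> #|addset A B|%:R <= K * #|A|%:R ->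
  exists A', [/\ A' \subset A, A' != set0 &
    forall m, #|sumset_iter A' B m|%:R <= K ^+ m * #|A'|%:R].
Proof.
move=> A0 AK; pose P X := (X \subset A) && (X != set0).
pose F X : R := #|addset X B|%:R / #|X|%:R.
have PA : P A by rewrite /P subxx.
case: (@arg_minP _ _ _ A P F PA) => A' /andP[A'A A'0] A'min.
have card_gt X : X != set0 -> 0 < #|X|%:R :> R by rewrite ltr0n card_gt0.
have FA' : F A' <= K.
  by apply: le_trans (A'min _ PA) _; rewrite ler_pdivrMr ?card_gt.
have F0 : 0 <= F A' by rewrite divr_ge0.
exists A'; split=> //; elim=> [|m IHm] /=; first by rewrite mul1r.
rewrite sumset_iterE -addsetA (addsetC _ B) addsetA.
have FAB X : X \subset A' -> F A' * #|X|%:R <= #|addset X B|%:R.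
  move=> XA'; have [->|X0] := eqVneq X set0; first by rewrite cards0 mulr0.
  rewrite -ler_pdivlMr ?card_gt //; apply: A'min.
  by rewrite /P (subset_trans XA').
have AFA : #|addset A' B|%:R <= F A' * #|A'|%:R.
  by rewrite divfK // lt0r_neq0 ?card_gt.
apply: le_trans (petridis F0 FAB AFA (sumset_iter [set 0] B m)) _.
by rewrite -sumset_iterE exprS -mulrA; apply: ler_pM.
Qed.

End FinitePluennecke.

(* Imported only here because it shadows the notations for finite sets. *)
From mathcomp Require Import finmap.
From mathcomp Require Import all_classical all_reals all_analysis.
Import Order.TTheory GRing.Theory Num.Theory.
Import numFieldNormedType.Exports.
Local Open Scope classical_set_scope.
Local Open Scope ring_scope.

(** * Box volumes and counting of grid points *)

Section Boxes.
Context {R : realType} {d : nat}.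
Implicit Types (a b w x : 'rV[R]_d) (h : 'rV[int]_d).

Lemma rvol_ge0 a b : 0 <= rvol a b.
Proof. by apply: prodr_ge0 => i _; rewrite le_max lexx. Qed.

Lemma ovol_ge0 (o : option ('rV[R]_d * 'rV[R]_d)) : 0 <= ovol o.
Proof. by case: o => // -[a b]; exact: rvol_ge0. Qed.

Lemma lebesgue_outer_ge0 (F : set 'rV[R]_d) : (0 <= lebesgue_outer F)%E.
Proof.
apply: le_ereal_inf_tmp => _ [c [_ ->]].
by apply: nneseries_ge0 => k _ _; rewrite lee_fin ovol_ge0.
Qed.

(** A finite list becomes a countable cover when padded with [None], which has volume 0. *)
Lemma lebesgue_outer_le_sum (F : set 'rV[R]_d) (s : seq ('rV[R]_d * 'rV[R]_d)) :
    (forall x, F x -> exists2 ab, ab \in s & rbox ab.1 ab.2 x) ->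
  (lebesgue_outer F <= (\sum_(ab <- s) rvol ab.1 ab.2)%:E)%E.
Proof.
move=> Fs; apply: ereal_inf_lbound; exists (fun k => nth None (map Some s) k).
split=> [x /Fs[ab abs abx]|].
  exists (index ab s) => //; rewrite (nth_map ab) ?index_mem //.
  by rewrite nth_index.
rewrite (nneseries_split 0 (size s)); last by move=> k _; rewrite lee_fin ovol_ge0.
rewrite add0n eseries0 ?adde0; last first.
  by move=> k sk _; rewrite nth_default // size_map.
rewrite -sumEFin (big_nth (0, 0)) big_nat_cond [RHS]big_nat_cond.
by apply: eq_bigr => k /andP[/andP[_ ks] _]; rewrite (nth_map (0, 0)).
Qed.

(** Subtracting the ceiling of [lo i] sends i-th coordinates into the integers from 0 to
    [trunc (w i)], so [H] injects into a product of sets with at most [w i + 1] elements. *)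
Lemma size_int_points_le (lo w : 'I_d -> R) (H : seq 'rV[int]_d) :
    uniq H -> (forall i, 0 <= w i) ->
    (forall h, h \in H -> forall i, lo i <= (h ord0 i)%:~R <= lo i + w i) ->
  (size H)%:R <= \prod_i (w i + 1).
Proof.
move=> uH w0 Hlo; pose t i := Num.trunc (w i).
pose f h : {dffun forall i : 'I_d, 'I_(t i).+1} :=
  [ffun i : 'I_d => inord `|h ord0 i - Num.ceil (lo i)|%N].
have fE h : h \in H -> forall i, (f h i : nat)%:Z = h ord0 i - Num.ceil (lo i).
  move=> hH i; have /andP[loh how] := Hlo h hH i.
  have ge0 : 0 <= h ord0 i - Num.ceil (lo i) by rewrite subr_ge0 ceil_le_int.
  rewrite ffunE inordK ?gez0_abs // ltnS truncn_ge_nat //.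
  rewrite natr_absz ger0_norm // rmorphB /= lerBlDr (le_trans how) //.
  by rewrite addrC lerD2l ceil_ge.
have injf : {in H &, injective f}.
  move=> h h' hH h'H ff; apply/rowP => i.
  by have := fE h hH i; rewrite ff fE // => /addIr.
have -> : (size H)%:R = (size (map f H))%:R :> R by rewrite size_map.
apply: (@le_trans _ _ #|{dffun forall i : 'I_d, 'I_(t i).+1}|%:R).
  rewrite ler_nat cardE; apply: uniq_leq_size => [|? _]; last by rewrite mem_enum.
  by rewrite map_inj_in_uniq.
rewrite card_dep_ffun foldrE big_map big_enum /= natr_prod.
apply: ler_prod => i _; rewrite ler0n card_ord /=.
by rewrite -natr1 lerD2r truncn_le.
Qed.

(** The product is a polynomial in [eta], continuous at 0. The 5 is the budget for counting grid
    points near a box: 2 for enlarging it on both sides, 2 for the distance [C / M] on both sides, 1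
    for the [+ 1] in [size_int_points_le]. *)
Lemma prodD_small (w : 'I_d -> R) (e : R) : 0 < e ->
  exists2 eta, 0 < eta & \prod_i (w i + 5 * eta) <= \prod_i w i + e.
Proof.
move=> e0; pose p := \prod_i ((w i)%:P + 5 *: 'X).
have pE t : p.[t] = \prod_i (w i + 5 * t).
  by rewrite horner_prod; apply: eq_bigr => i _; rewrite !hornerE.
have : p.[t] @[t --> 0] --> p.[0] by exact: continuous_horner.
move=> /cvgrPdist_lt /(_ e e0); rewrite near_simpl => -[r /= r0 pr].
exists (r / 2); first by rewrite divr_gt0.
have /pr : ball_ Num.norm 0 r (r / 2).
  by rewrite /= sub0r normrN gtr0_norm ?divr_gt0 // ltr_pdivrMr //; lra.
rewrite distrC !pE mulr0 => /ltr_distlDr/ltW; congr (_ <= _ + _).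
by apply: eq_bigr => i _; rewrite addr0.
Qed.

Lemma size_le_sum_count (T : eqType) (I : Type) (s : seq I) (P : I -> pred T)
    (H : seq T) : (forall t, t \in H -> has (P^~ t) s) ->
  (size H <= \sum_(i <- s) size [seq t <- H | P i t])%N.
Proof.
move=> HP; under eq_bigr do rewrite size_filter -sum1_count big_mkcond.
rewrite exchange_big /= -sum1_size big_seq [leqRHS]big_seq.
apply: leq_sum => t /HP; rewrite -big_mkcond sum1_count.
by rewrite has_count.
Qed.

Lemma eventually_natM (s : seq nat) (eta : nat -> R) (C : R) :
    (forall k, 0 < eta k) ->
  exists N : nat, forall M k, (N <= M)%N -> k \in s -> C <= M%:R * eta k.
Proof.
move=> eta0; elim: s => [|k s [N IH]]; first by exists 0%N.
exists (maxn N (Num.trunc (C / eta k)).+1) => M k'.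
rewrite geq_max => /andP[NM kM]; rewrite inE => /predU1P[->|/IH]; last exact.
rewrite -ler_pdivrMr //; apply/ltW/(lt_le_trans (truncnS_gt _)).
by rewrite ler_nat.
Qed.

Lemma sum_half_le (e : R) n : 0 <= e -> \sum_(k < n) (e / 2 ^+ k.+1) <= e.
Proof.
move=> e0; suff -> : \sum_(k < n) (e / 2 ^+ k.+1) = e - e / 2 ^+ n.
  by rewrite gerBl divr_ge0 ?exprn_ge0.
elim: n => [|n IH]; first by rewrite big_ord0 divr1 subrr.
rewrite big_ord_recr /= IH exprS; field.
by rewrite expf_neq0.
Qed.

End Boxes.

Section GridCount.
Context {R : realType} {d : nat}.
Implicit Types (a b x : 'rV[R]_d) (h : 'rV[int]_d).

Lemma open_box a b : open [set x : 'rV[R]_d | forall i, a ord0 i < x ord0 i < b ord0 i].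
Proof.
rewrite openE => x /= xab; apply: (@filter_forall _ _
  (fun i => [set y : 'rV[R]_d | a ord0 i < y ord0 i < b ord0 i]) (nbhs x)) => i.
have xi : nbhs (x ord0 i) [set t | a ord0 i < t < b ord0 i].
  have : x ord0 i \in `]a ord0 i, b ord0 i[ by rewrite in_itv; exact: xab.
  by move=> /near_in_itvoo; apply: filterS => t; rewrite in_itv.
exact: (@coord_continuous R 1 d ord0 i x _ xi).
Qed.

(* Enlarge the boxes of the cover slightly, extract a finite subcover, and
   count the grid points in each of the finitely many enlarged boxes. *)
Lemma size_grid_points_near (F : set 'rV[R]_d)
    (c : nat -> option ('rV[R]_d * 'rV[R]_d)) (s e C : R) :
    compact F -> F `<=` \bigcup_k obox (c k) ->
    (\sum_(0 <= k <oo) (ovol (c k))%:E <= s%:E)%E -> 0 < e ->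
  exists N : nat, forall M : nat, (N <= M)%N -> forall H : seq 'rV[int]_d,
    uniq H ->
    (forall h, h \in H -> exists2 x, F x &
       forall i, `|(h ord0 i)%:~R - M%:R * x ord0 i| <= C) ->
  (size H)%:R <= M%:R ^+ d * (s + e).
Proof.
move=> cF Fc cs e0.
(* The k-th box may gain volume [e / 2 ^+ k.+1], so that all gains together stay below [e]. *)
have etaP k : exists eta : R, 0 < eta /\ forall a b, c k = Some (a, b) ->
    \prod_i (Num.max 0 (b ord0 i - a ord0 i) + 5 * eta)
      <= ovol (c k) + e / 2 ^+ k.+1.
  case: (c k) => [[a b]|]; last by exists 1.
  have [|eta eta0 etale] := @prodD_small R d
    (fun i => Num.max 0 (b ord0 i - a ord0 i)) (e / 2 ^+ k.+1).
    by rewrite divr_gt0 ?exprn_gt0.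
  by exists eta; split=> // _ _ [<- <-].
have [eta {}etaP] := choice etaP.
have eta0 k : 0 < eta k by case: (etaP k).
pose O k : set 'rV[R]_d := if c k is Some ab then
  [set x | forall i, (ab.1 - const_mx (eta k)) ord0 i < x ord0 i
                     < (ab.2 + const_mx (eta k)) ord0 i] else set0.
have openO k : open (O k).
  by rewrite /O; case: (c k) => [ab|]; [exact: open_box|exact: open0].
have FO : F `<=` cover setT O.
  move=> x /Fc[k _ ckx]; exists k => //; move: ckx; rewrite /O.
  case: (c k) => [[a b]|//] abx i; have := abx i; rewrite !mxE /=.
  by have := eta0 k; lra.
have ccF : cover_compact F by rewrite -compact_cover.
have [D _ FD] := ccF nat setT O (fun k _ => openO k) FO.
have [n Dn] : exists n, forall k, k \in D -> (k < n)%N.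
  by exists (\max_(k <- D) k).+1 => k kD; rewrite ltnS; apply: leq_bigmax_seq.
(* Since only the boxes with [k < n] remain, one [N] makes both [C / M] and [1 / M] at most [eta k]
   for all of them. *)
have [N Nle] := eventually_natM (iota 0 n) (`|C| + 1) eta0.
exists N => M NM H uH HF.
pose P k h := `[< exists2 x, O k x &
  forall i, `|(h ord0 i)%:~R - M%:R * x ord0 i| <= C >].
have HP h : h \in H -> has (P^~ h) (iota 0 n).
  move=> /HF[x /FD[k kD Okx] hx]; apply/hasP; exists k; last by apply/asboolP; exists x.
  by rewrite mem_iota add0n /= Dn //; move: kD.
have sizeP k : k \in iota 0 n -> (size [seq h <- H | P k h])%:R
    <= M%:R ^+ d * (ovol (c k) + e / 2 ^+ k.+1).
  move=> /(Nle _ _ NM) Meta.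
  case ck: (c k) => [[a b]|]; last first.
    rewrite (eq_filter (a2 := pred0)) ?filter_pred0 => [|h].
      by rewrite mulr_ge0 ?exprn_ge0 // addr_ge0 // divr_ge0 ?exprn_ge0 // ltW.
    by apply/negbTE/negP => /asboolP[x]; rewrite /O ck.
  have [_ /(_ _ _ ck) etale] := etaP k.
  pose W i := Num.max 0 (b ord0 i - a ord0 i).
  have W0 i : 0 <= W i by rewrite le_max lexx.
  have Wge i : b ord0 i - a ord0 i <= W i by rewrite le_max lexx orbT.
  have M0 : (0 : R) <= M%:R by [].
  have e0' := eta0 k.
  apply: le_trans (_ : M%:R ^+ d * \prod_i (W i + 5 * eta k) <= _); last first.
    by rewrite ler_wpM2l ?exprn_ge0 // -ck.
  apply: le_trans (@size_int_points_le R d (fun i => M%:R * (a ord0 i - 2 * eta k))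
    (fun i => M%:R * (W i + 4 * eta k)) _ _ _ _) _.
  - exact: filter_uniq.
  - by move=> i; rewrite mulr_ge0 // addr_ge0 // mulr_ge0 // ltW.
  - move=> h; rewrite mem_filter => /andP[/asboolP[x Okx hx] _] i.
    move: Okx; rewrite /O ck => /(_ i); rewrite !mxE /= => /andP[ax xb].
    have := ler_wpM2l M0 (ltW ax); have := ler_wpM2l M0 (ltW xb).
    have := ler_wpM2l M0 (Wge i).
    have := hx i; rewrite ler_norml => /andP[]; have := ler_norm C.
    move: Meta; move: (M%:R : R) (h ord0 i)%:~R => m hi.
    by rewrite !mulrDr !mulrN => *; apply/andP; split; lra.
  - have -> : M%:R ^+ d = \prod_(i < d) M%:R :> R by rewrite prodr_const card_ord.
    rewrite -big_split /=; apply: ler_prod => i _.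
    rewrite addr_ge0 ?mulr_ge0 // ?addr_ge0 ?mulr_ge0 ?(ltW e0') //=.
    have := normr_ge0 C; lra.
apply: (@le_trans _ _ (\sum_(k <- iota 0 n) size [seq h <- H | P k h])%:R).
  by rewrite ler_nat size_le_sum_count.
rewrite natr_sum big_seq; apply: le_trans (ler_sum _ sizeP) _.
rewrite -big_seq -mulr_sumr ler_wpM2l ?exprn_ge0 // big_split /=.
rewrite -[n in iota 0 n]subn0 -/(index_iota 0 n) !big_mkord lerD ?sum_half_le ?(ltW e0) //.
rewrite -lee_fin -sumEFin; apply: le_trans cs.
rewrite -(big_mkord xpredT (fun k => (ovol (c k))%:E)).
by apply: nneseries_lim_ge => k _ _; rewrite lee_fin ovol_ge0.
Qed.

End GridCount.

(** * The group structure and topology of the torus *)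

Section Torus.
Context {R : realType} {d : nat} {Z : finZmodType}.
Implicit Types (x y : 'rV[R]_d) (h : 'rV[int]_d) (A B : set (@TZ R d Z)).

Lemma tproj_addz x h : tproj (x + map_mx intr h) = tproj x.
Proof.
apply: val_inj; apply/rowP => i; rewrite !mxE /fracr floorDrz ?intr_int //.
by rewrite intrKfloor rmorphD /= opprD addrACA subrr addr0.
Qed.

Lemma tproj_lift x : exists h, proj1_sig (tproj x) = x + map_mx intr h.
Proof.
by exists (- map_mx Num.floor x); apply/rowP => i; rewrite !mxE rmorphN.
Qed.

Lemma tproj_inj x y : tproj x = tproj y -> exists h, x = y + map_mx intr h.
Proof.
have [h xh] := tproj_lift x; have [k yk] := tproj_lift y.
move=> xy; move: xh; rewrite xy yk => xh; exists (k - h).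
by rewrite map_mxB addrA xh addrK.
Qed.

Lemma tproj_val (t : @torus R d) : tproj (proj1_sig t) = t.
Proof.
apply: val_inj; apply/rowP => i; rewrite !mxE /fracr.
rewrite (_ : Num.floor _ = 0) ?subr0 //; apply: floor_def.
by rewrite add0r; have /forallP/(_ i) := proj2_sig t.
Qed.

Lemma tzadd_tproj x y (z w : Z) :
  tzadd (tproj x, z) (tproj y, w) = (tproj (x + y), z + w).
Proof.
rewrite -[tzadd _ _]/(tproj (proj1_sig (tproj x) + proj1_sig (tproj y)), z + w).
have [h ->] := tproj_lift x; have [k ->] := tproj_lift y.
by rewrite addrACA -map_mxD tproj_addz.
Qed.

Lemma TZ_ex (p : @TZ R d Z) : exists x z, p = (tproj x, z).
Proof. by case: p => t z; exists (proj1_sig t), z; rewrite tproj_val. Qed.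

Lemma tzaddA (p q r : @TZ R d Z) : tzadd p (tzadd q r) = tzadd (tzadd p q) r.
Proof.
have [x [u ->]] := TZ_ex p; have [y [v ->]] := TZ_ex q.
by have [t [w ->]] := TZ_ex r; rewrite !tzadd_tproj !addrA.
Qed.

(** If [x] is outside the sum, each [x - u] with [u] in [A] lies in the open complement of [B];
    compactness of [A] makes a neighbourhood of [x] work for all [u] at once. *)
Lemma closed_compactD (A B : set 'rV[R]_d) : compact A -> closed B ->
  closed [set x : 'rV[R]_d | exists2 u, A u & B (x - u)].
Proof.
move=> /compact_near_coveringP cA /closed_openC; rewrite openE => oB.
rewrite -openC openE => x /= xAB.
have : \near x, A `<=` (fun u => ~ B (x - u)).
  apply: (cA _ (nbhs x) (fun y u => ~ B (y - u))) => u Au.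
  have : (~` B) (x - u) by move=> Bxu; apply: xAB; exists u.
  move=> /oB; rewrite /interior => nB.
  have sub_cvg : (fun p : 'rV[R]_d * 'rV[R]_d => p.2 - p.1) @ (nbhs u, nbhs x) --> x - u.
    by apply: cvgB; [exact: cvg_snd|exact: cvg_fst].
  exact: (sub_cvg _ nB).
by apply: filterS => y yA [u Au Byu]; exact: yA Au Byu.
Qed.

Lemma compact_box (a b : 'I_d -> R) :
  compact [set x : 'rV[R]_d | forall i, a i <= x ord0 i <= b i].
Proof.
have := @rV_compact R d (fun i => [set` `[a i, b i]])
  (fun i => @segment_compact R (a i) (b i)).
by congr compact; apply/seteqP; split=> x xab i; have := xab i; rewrite /= in_itv.
Qed.

Lemma compact_cubeI (D : set 'rV[R]_d) : closed D ->
  compact ([set x : 'rV[R]_d | forall i, 0 <= x ord0 i <= 1] `&` D).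
Proof.
move=> cD.
have c01 : compact [set x : 'rV[R]_d | forall i, 0 <= x ord0 i <= 1].
  exact: (@compact_box (fun=> 0) (fun=> 1)).
apply: (@subclosed_compact _ _ [set x : 'rV[R]_d | forall i, 0 <= x ord0 i <= 1]).
- by apply: closedI => //; apply: compact_closed; [exact: norm_hausdorff|].
- by [].
- by move=> x [].
Qed.

Lemma closed_coord (D : set R) i : closed D -> closed [set x : 'rV[R]_d | D (x ord0 i)].
Proof.
move=> cD; apply: (@preimage_closed _ _ (fun x : 'rV[R]_d => x ord0 i)) => //.
by move=> x _; exact: coord_continuous.
Qed.

Lemma closed_forall (T : topologicalType) (I : Type) (F : I -> set T) :
  (forall i, closed (F i)) -> closed [set x | forall i, F i x].
Proof.
move=> cF; rewrite (_ : [set x | _] = \bigcap_(i in setT) F i); last first.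
  by apply/seteqP; split=> [x Fx i _|x Fx i]; exact: Fx.
by apply: closed_bigI.
Qed.

Lemma closed_intr : closed [set t : R | exists n : int, t = n%:~R].
Proof.
rewrite -openC openE => t /= tn.
have /near_in_itvoo : t \in `](Num.floor t)%:~R, (Num.floor t + 1)%:~R[.
  have := floor_itv t; rewrite in_itv /= => /andP[lt_t ->]; rewrite andbT.
  by rewrite lt_neqAle lt_t andbT; apply/eqP => tE; apply: tn; exists (Num.floor t).
apply: filterS => s; rewrite in_itv /= => /andP[ts st] [n sn].
by move: ts st; rewrite sn !ltr_int; lia.
Qed.

Lemma closed_intr_rV : closed [set x : 'rV[R]_d | exists h, x = map_mx intr h].
Proof.
have := closed_forall (fun i : 'I_d => closed_coord (i := i) closed_intr).
congr closed; apply/seteqP; split=> x /=; last first.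
  by move=> [h ->] i; exists (h ord0 i); rewrite mxE.
by move=> /choice[f fE]; exists (\row_i f i); apply/rowP => i; rewrite !mxE.
Qed.

(** A fibre of the sum is a finite union over the [Z]-component [w] of the first summand. That
    summand is represented in the closed unit cube, hence compactly, while [B] keeps its full
    periodic closed preimage. *)
Lemma closedTZ_sumset A B : closedTZ A -> closedTZ B -> closedTZ (sumset A B).
Proof.
move=> cA cB z.
pose F (w : Z) := [set x | exists2 u,
  ([set x : 'rV[R]_d | forall i, 0 <= x ord0 i <= 1] `&` [set x | A (tproj x, w)]) u &
  [set x | B (tproj x, z - w)] (x - u)].
have -> : [set x | sumset A B (tproj x, z)] = \bigcup_(w in [set: Z]) F w.
  apply/seteqP; split=> x /=.
    move=> [p [q [Ap [Bq]]]]; have [y [v qE]] := TZ_ex q.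
    case: p Ap => u w Ap; rewrite qE -{1}(tproj_val u) tzadd_tproj => pE.
    have /= zE := congr1 snd pE; have {pE} xE := congr1 fst pE.
    exists w => //; exists (proj1_sig u).
      split=> /=; last by rewrite tproj_val.
      by move=> i; have /forallP/(_ i)/andP[-> /ltW] := proj2_sig u.
    have [h xh] := tproj_inj xE; move: Bq; rewrite qE /= zE xh.
    have -> : proj1_sig u + y + map_mx intr h - proj1_sig u = y + map_mx intr h.
      by rewrite -[_ + y + _]addrA addrAC subrr add0r.
    by rewrite tproj_addz addrAC subrr add0r.
  move=> [w _ [u [_ Au] Bxu]]; exists (tproj u, w), (tproj (x - u), z - w).
  by split=> //; split=> //; rewrite tzadd_tproj !(addrC _ (_ - _)) !subrK.
apply: closed_bigcup => [|w _]; first exact: finite_finset.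
by apply: closed_compactD; [apply: compact_cubeI; exact: cA|exact: cB].
Qed.

End Torus.

(** * Discretization *)

Section Grid.
Context {R : realType} {d : nat} {Z : finZmodType} {m : nat}.
Implicit Types (x y : 'rV[R]_d) (h k : 'rV[int]_d).

(** A copy of the grid of mesh [1/M] with [M = m.+2]. The successors make ['I_m.+2] a ring, so that
    [intr] is reduction modulo [M]. *)
Definition grid : finZmodType := (prod (matrix (ordinal m.+2) 1 d) Z)%type.
Implicit Types (S T : {set grid}) (K : set (@TZ R d Z)).

(** [h] is an integer lift of the lower corner and [x] any lift of the torus point, so cells may
    wrap around. *)
Definition cells S : set (@TZ R d Z) := [set p | exists x h,
  [/\ p.1 = tproj x, ((map_mx intr h, p.2) : grid) \in S &
      forall i, (h ord0 i)%:~R <= m.+2%:R * x ord0 i <= (h ord0 i)%:~R + 1]].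

(** [C] is measured in mesh units: the actual distance is at most [C / M] in each coordinate. *)
Definition grid_near K (C : R) (g : grid) : Prop := exists x h,
  [/\ K (tproj x, g.2), g.1 = map_mx intr h &
      forall i, `|(h ord0 i)%:~R - m.+2%:R * x ord0 i| <= C].

Lemma grid_near_sumset K K' C C' g g' :
    grid_near K C g -> grid_near K' C' g' ->
  grid_near (sumset K K') (C + C') (g + g').
Proof.
move=> [x [h [Kx gh xh]]] [x' [h' [Kx' gh' xh']]]; exists (x + x'), (h + h'); split.
- by exists (tproj x, g.2), (tproj x', g'.2); rewrite tzadd_tproj.
- by rewrite map_mxD -gh -gh'.
- move=> i; rewrite !mxE rmorphD mulrDr /= opprD addrACA.
  by apply: le_trans (ler_normD _ _) _; exact: lerD.
Qed.

(** In each coordinate, a cell translated by [y] meets only the cells shifted by [floor (M y)] and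
    [floor (M y) + 1], and [k] picks the one containing [x + y]. Both shifts are within one mesh
    unit of [M y], so the corner given by [k] is in [T]. *)
Lemma cells_add S T K p q : (forall g, grid_near K 1 g -> g \in T) ->
  cells S p -> K q -> cells (addset S T) (tzadd p q).
Proof.
move=> KT; case: p => _ z [x [h [/= -> hS xh]]].
have [y [w ->]] := TZ_ex q => Ky.
pose k := \row_i (let f := Num.floor (m.+2%:R * y ord0 i) in
  if m.+2%:R * (x + y) ord0 i <= (h ord0 i + f)%:~R + 1 then f else f + 1).
exists (x + y), (h + k); split; first by rewrite tzadd_tproj.
  rewrite tzadd_tproj /= map_mxD.
  apply: (@mem_addset _ _ _ (map_mx intr h, z) (map_mx intr k, w) hS).
  apply: KT; exists y, k; split=> // i; rewrite !mxE /=.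
  have := floor_itv (m.+2%:R * y ord0 i); move: (m.+2%:R * _) => u.
  by case: ifP => _; rewrite rmorphD /= ler_norml => /andP[? ?]; apply/andP; split; lra.
move=> i; rewrite !mxE /= mulrDr; have := xh i.
have := floor_itv (m.+2%:R * y ord0 i).
move: (m.+2%:R * y _ _) (m.+2%:R * x _ _) => u t.
by rewrite !rmorphD /=; case: ifP => /=; rewrite ?rmorphD /=; lra.
Qed.

Lemma intr_modulus : (m.+2%:Z)%:~R = 0 :> 'I_m.+2.
Proof. by apply: val_inj; rewrite -pmulrn Zp_nat /= modnn. Qed.

Lemma map_intrDM h k :
  map_mx intr (h + m.+2%:Z *: k) = map_mx intr h :> 'rV['I_m.+2]_d.
Proof. by apply/rowP => i; rewrite !mxE intrD intrM intr_modulus mul0r addr0. Qed.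

Lemma map_intr_val (g : 'rV['I_m.+2]_d) :
  map_mx intr (\row_i (g ord0 i : nat)%:Z) = g.
Proof. by apply/rowP => i; rewrite !mxE -pmulrn Zp_nat valZpK. Qed.

Lemma grid_lift h : exists k, forall i,
  h ord0 i = ((map_mx intr h : 'rV['I_m.+2]_d) ord0 i : nat)%:Z + m.+2%:Z * k ord0 i.
Proof.
exists (map_mx (fun t => t %/ m.+2%:Z)%Z h) => i; rewrite !mxE.
rewrite {1}(divz_eq (h ord0 i) m.+2%:Z) addrC mulrC; congr (_ + _).
rewrite {2}(divz_eq (h ord0 i) m.+2%:Z) intrD intrM intr_modulus mulr0 add0r.
have := modz_ge0 (h ord0 i) (isT : m.+2%:Z != 0).
have : ((h ord0 i) %% m.+2%:Z < m.+2%:Z)%Z by rewrite ltz_pmod.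
case: (_ %% _)%Z => // n nm _.
by rewrite -pmulrn Zp_nat /= modn_small.
Qed.

(** The preimage of a fibre is a finite union of sums of a compact box and the closed lattice of
    integer vectors. *)
Lemma closedTZ_cells S : closedTZ (cells S).
Proof.
move=> z; pose F (g : grid) : set 'rV[R]_d := [set x | exists2 u,
  [set x : 'rV[R]_d | forall i, (g.1 ord0 i : nat)%:R / m.+2%:R <= x ord0 i
                      <= ((g.1 ord0 i : nat)%:R + 1) / m.+2%:R] u &
  [set x : 'rV[R]_d | exists h, x = map_mx intr h] (x - u)].
have -> : [set x | cells S (tproj x, z)] =
    \bigcup_(g in [set g | (g \in S) && (g.2 == z)]) F g.
  apply/seteqP; split=> x /=.
    move=> [y [h [/= xy hS yh]]]; exists (map_mx intr h, z); first by rewrite /= hS eqxx.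
    have [k hk] := grid_lift h; exists (y - map_mx intr k).
      move=> i /=; rewrite ler_pdivrMr // ler_pdivlMr // ![_ * m.+2%:R]mulrC.
      have := yh i; rewrite hk rmorphD rmorphM /= -!pmulrn.
      rewrite [(y - _) _ _]mxE [(- map_mx _ k) _ _]mxE [map_mx _ k _ _]mxE mulrBr.
      lra.
    have [l ->] := tproj_inj xy; exists (l + k).
    by apply/rowP => i; rewrite !mxE rmorphD /=; ring.
  move=> [[g z'] /= /andP[gS /eqP <-]] [u ug [h xuh]].
  exists u, (\row_i (g ord0 i : nat)%:Z); split=> /=.
  - by rewrite -(tproj_addz u h) -xuh addrC subrK.
  - by rewrite map_intr_val.
  - by move=> i; have := ug i; rewrite mxE -pmulrn ler_pdivrMr // ler_pdivlMr // mulrC.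
apply: closed_bigcup => [|g _]; first exact: finite_finset.
by apply: closed_compactD; [exact: compact_box|exact: closed_intr_rV].
Qed.

End Grid.
Arguments grid d Z m : clear implicits.

(** * Comparison of grid densities with Haar measure *)

Section Density.
Context {R : realType} {d : nat} {Z : finZmodType}.
Implicit Types (x y : 'rV[R]_d) (h : 'rV[int]_d) (K : set (@TZ R d Z)).

Definition fiber K z : set 'rV[R]_d := [set x | in_unit_cube x /\ K (tproj x, z)].

Definition dens m (S : {set grid d Z m}) : R :=
  #|S|%:R / (m.+2%:R ^+ d * #|Z|%:R).

Lemma lebesgue_outer_fiber_fin K z : lebesgue_outer (fiber K z) \is a fin_num.
Proof.
rewrite ge0_fin_numE ?lebesgue_outer_ge0 //.
apply: le_lt_trans (lebesgue_outer_le_sum (s := [:: (0, const_mx 1)]) _) (ltry _).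
move=> x [/forallP xc _]; exists (0, const_mx 1); rewrite ?inE // => i /=.
by rewrite !mxE; have /andP[-> /ltW] := xc i.
Qed.

Lemma haarE K :
  haar K = (#|Z|%:R^-1 * \sum_z fine (lebesgue_outer (fiber K z)))%:E.
Proof.
rewrite EFinM -sumEFin; congr (_ * _)%E; apply: eq_bigr => z _.
by rewrite fineK // lebesgue_outer_fiber_fin.
Qed.

Lemma card_sum_fibers m (S : {set grid d Z m}) :
  #|S| = (\sum_z size [seq g <- enum S | g.2 == z])%N.
Proof.
rewrite cardE -sum1_size (partition_big (fun g => g.2) xpredT) //=.
by apply: eq_bigr => z _; rewrite sum1_count size_filter.
Qed.

Lemma densE m (S : {set grid d Z m}) : dens S =
  #|Z|%:R^-1 * \sum_z ((size [seq g <- enum S | g.2 == z])%:R / m.+2%:R ^+ d).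
Proof.
by rewrite /dens card_sum_fibers natr_sum -mulr_suml [RHS]mulrC -mulrA -invfM.
Qed.

(** Each fibre of [K] is covered by one box of volume [1 / M ^ d] per point of [S] over [z],
    together with null faces. *)
Lemma haar_le_dens m (S : {set grid d Z m}) K :
  K `<=` cells S -> (haar K <= (dens S)%:E)%E.
Proof.
move=> KS; rewrite haarE densE lee_fin ler_wpM2l ?invr_ge0 //.
apply: ler_sum => z _; rewrite -lee_fin fineK ?lebesgue_outer_fiber_fin //.
pose box (g : grid d Z m) : 'rV[R]_d * 'rV[R]_d :=
  (\row_i ((g.1 ord0 i : nat)%:R / m.+2%:R),
   \row_i (((g.1 ord0 i : nat)%:R + 1) / m.+2%:R)).
(* A point with a zero coordinate may belong only to a cell ending at 1 and wrapping around, whose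
   box misses it. The faces where [x_j = 0] catch such points at volume 0. *)
pose face (j : 'I_d) : 'rV[R]_d * 'rV[R]_d := (0, \row_i (i != j)%:R).
pose s := [seq box g | g <- enum S & g.2 == z] ++ [seq face j | j <- enum 'I_d].
have -> : (size [seq g <- enum S | g.2 == z])%:R / m.+2%:R ^+ d
    = \sum_(ab <- s) rvol ab.1 ab.2.
  rewrite /s big_cat !big_map /= [X in _ = _ + X]big1 ?addr0; last first.
    move=> j _; rewrite /rvol /= (bigD1 j) //= !mxE eqxx subrr.
    by rewrite /Num.max ltxx mul0r.
  under eq_bigr => g _.
    rewrite /rvol /= (eq_bigr (fun=> m.+2%:R^-1)) => [|i _]; last first.
      by rewrite !mxE -mulrBl addrC addKr mul1r; apply/max_r; rewrite invr_ge0.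
    rewrite prodr_const card_ord exprVn; over.
  by rewrite /= big_const_seq iter_addr_0 count_predT mulr_natl.
apply: lebesgue_outer_le_sum => x [/forallP xc] /KS[y [h [/= /tproj_inj[l xy] hS yh]]].
have [/existsP[j /eqP xj]|/existsPn xn0] := boolP [exists j, x ord0 j == 0].
  exists (face j); first by rewrite mem_cat (map_f face) ?mem_enum ?orbT.
  move=> i /=; rewrite !mxE; have /andP[-> /ltW] /= := xc i.
  by have [->|] := eqVneq i j; rewrite ?xj.
pose k := h + m.+2%:Z *: l.
have kh : map_mx intr k = map_mx intr h :> 'rV['I_m.+2]_d by exact: map_intrDM.
have xk i : (k ord0 i)%:~R <= m.+2%:R * x ord0 i <= (k ord0 i)%:~R + 1.
  by have := yh i; rewrite xy !mxE rmorphD rmorphM /= mulrDr -!pmulrn; lra.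
move: (k) kh xk => {}k kh xk.
exists (box (map_mx intr k, z)).
  by rewrite mem_cat map_f // mem_filter eqxx mem_enum kh.
move=> i; rewrite /box /= !mxE ler_pdivrMr // ler_pdivlMr // [_ * m.+2%:R]mulrC.
have /andP[x0 x1] := xc i; have {}x0 : 0 < x ord0 i by rewrite lt0r xn0.
have /andP[kx xk1] := xk i.
(* From [0 < x_i < 1] follows [0 <= k_i < M], so [k_i] is its own residue and the box of that
   residue contains [x]. *)
have k0 : 0 <= k ord0 i.
  rewrite -ltzD1 -(ltr0z R) intrD; apply: lt_le_trans xk1.
  by rewrite mulr_gt0.
have km : k ord0 i < m.+2%:Z.
  rewrite -(ltr_int R); apply: le_lt_trans kx _.
  by rewrite -[ltRHS]mulr1 ltr_pM2l -?pmulrn.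
have := xk i; move: k0 km; case: (k ord0 i) => // n _ nm.
by rewrite -!pmulrn Zp_nat /= modn_small.
Qed.

(** The fibre over the half-open cube may fail to be compact, so the count is done on its
    closed-cube version [F]. Half of [e] pays for a near-optimal cover, half for the count. *)
Lemma size_grid_points_fiber K z (C e : R) : closedTZ K -> 0 < e ->
  exists N : nat, forall M : nat, (N <= M)%N -> forall H : seq 'rV[int]_d,
    uniq H ->
    (forall h, h \in H -> exists2 x, fiber K z x &
       forall i, `|(h ord0 i)%:~R - M%:R * x ord0 i| <= C) ->
  (size H)%:R <= M%:R ^+ d * (fine (lebesgue_outer (fiber K z)) + e).
Proof.
move=> cK e0; have e20 : 0 < e / 2 by rewrite divr_gt0.
have Kfin := lebesgue_outer_fiber_fin K z.
have [_ [c [Kc ->]] cK2] := lb_ereal_inf_adherent e20 Kfin.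
(* Closing the cube adds only points with a coordinate 1; [d] degenerate boxes placed before the
   cover [c] contain them and add no volume. *)
pose face (j : nat) : option ('rV[R]_d * 'rV[R]_d) :=
  Some (\row_i (val i == j)%:R, const_mx 1).
pose c' k := if (k < d)%N then face k else c (k - d)%N.
pose F : set 'rV[R]_d :=
  [set x : 'rV[R]_d | forall i, 0 <= x ord0 i <= 1] `&` [set x | K (tproj x, z)].
have cF : compact F by apply: compact_cubeI; exact: cK.
have Fc' : F `<=` \bigcup_k obox (c' k).
  move=> x [x01 Kx].
  have [/existsP[j /eqP xj]|/existsPn xn1] := boolP [exists j, x ord0 j == 1].
    exists (val j) => //; rewrite /c' ltn_ord => i; rewrite !mxE.
    have /andP[x0 ->] := x01 i; rewrite andbT.
    by have [/val_inj->|] := eqVneq; rewrite ?xj.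
  have /Kc[k _ ckx] : fiber K z x.
    split=> //; apply/forallP => i; have /andP[-> x1] := x01 i.
    by rewrite lt_neqAle xn1.
  by exists (k + d)%N => //; rewrite /c' ltnNge leq_addl addnK.
have c'le : (\sum_(0 <= k <oo) (ovol (c' k))%:E
    <= (fine (lebesgue_outer (fiber K z)) + e / 2)%:E)%E.
  have ov0 k : (0 <= (ovol (c' k))%:E)%E by rewrite lee_fin ovol_ge0.
  rewrite (nneseries_split 0 d) // add0n big_mkord big1 ?add0e => [|j _]; last first.
    rewrite /c' ltn_ord /= /rvol (bigD1 j) //= !mxE eqxx subrr.
    by rewrite /Num.max ltxx mul0r.
  rewrite -nneseries_addn // EFinD fineK // ltW //.
  rewrite (eq_eseriesr (g := fun k => (ovol (c k))%:E)) // => k _.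
  by rewrite /c' ltnNge leq_addl addnK.
have [N NP] := size_grid_points_near C cF Fc' c'le e20.
exists N => M NM H uH HK.
apply: le_trans (NP M NM H uH _) _; last by rewrite -addrA -splitr.
move=> h /HK[x [/forallP xc Kx] hx]; exists x => //; split=> // i.
by have /andP[-> /ltW] := xc i.
Qed.

(** The points of [S] are counted fibre by fibre through integer lifts; closedness of [K] supplies
    the compactness behind [size_grid_points_fiber]. *)
Lemma dens_le_haar K (C e : R) : closedTZ K -> 0 < e ->
  exists N : nat, forall m (S : {set grid d Z m}), (N <= m)%N ->
    (forall g, g \in S -> grid_near K C g) -> ((dens S)%:E <= haar K + e%:E)%E.
Proof.
move=> cK e0.
have [N NP] := choice (fun z => size_grid_points_fiber z C cK e0).
exists (\max_z N z)%N => m S Nm SK; rewrite haarE -EFinD lee_fin densE.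
have Z0 : 0 < #|Z|%:R :> R by rewrite ltr0n; apply/card_gt0P; exists 0.
have -> : e = #|Z|%:R^-1 * \sum_(z : Z) e.
  by rewrite sumr_const -[e *+ _]mulr_natl mulKf // lt0r_neq0.
rewrite -mulrDr -big_split /= ler_wpM2l ?invr_ge0 ?(ltW Z0) //.
apply: ler_sum => z _; rewrite ler_pdivrMr ?exprn_gt0 // mulrC.
(* [f g] lifts [g] near a point of the half-open cube: moving the point by an integer vector moves
   the lift by [M] times that vector. *)
have /choice[f fP] : forall g : grid d Z m, exists h : 'rV[int]_d, g \in S ->
    exists2 x, fiber K g.2 x & g.1 = map_mx intr h /\
      forall i, `|(h ord0 i)%:~R - m.+2%:R * x ord0 i| <= C.
  move=> g; have [gS|_] := boolP (g \in S); last by exists 0.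
  have [x [h [Kx gh xh]]] := SK g gS; have [k xk] := tproj_lift x.
  exists (h + m.+2%:Z *: k) => _; exists (proj1_sig (tproj x)).
    by split; [exact: (proj2_sig (tproj x))|rewrite tproj_val].
  split=> [|i]; first by rewrite map_intrDM.
  rewrite xk !mxE rmorphD rmorphM /= mulrDr -!pmulrn opprD addrACA subrr addr0.
  exact: xh.
rewrite -(size_map f); apply: NP.
- by apply: leq_trans (leq_trans (leq_bigmax z) Nm) _; rewrite -addn2 leq_addr.
- rewrite map_inj_in_uniq; first exact: (filter_uniq _ (enum_uniq _)).
  move=> g g'.
  rewrite !(mem_filter _ _ (enum _)) !mem_enum.
  move=> /andP[/eqP gz gS] /andP[/eqP gz' gS'] fgg'.
  have [_ _ [g1 _]] := fP g gS; have [_ _ [g1' _]] := fP g' gS'.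
  by rewrite [g]surjective_pairing [g']surjective_pairing gz gz' g1 g1' fgg'.
- move=> h /mapP[g]; rewrite mem_filter mem_enum => /andP[/eqP <- gS] ->.
  by have [x Kx [_ xh]] := fP g gS; exists x.
Qed.

(** Cutting every cell into [n ^ d] subcells keeps the density and puts the new corners exactly in
    [cells S], so that [dens_le_haar] can be used on an arbitrarily fine mesh. *)
Lemma refine_cells m n (S : {set grid d Z m}) : (0 < n)%N ->
  exists m' (S' : {set grid d Z m'}), [/\ m'.+2 = (m.+2 * n)%N,
    forall g, g \in S' -> grid_near (cells S : set (@TZ R d Z)) 0 g & dens S' = dens S].
Proof.
move=> n0; have [m' m'E] : exists m', m'.+2 = (m.+2 * n)%N.
  by exists (m.+2 * n).-2; case: n n0 => // n _; lia.
(* The new index of offset [r] in the old cell [g]; quotient and remainder by [n] recover both,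
   whence [f] is injective. *)
pose u (g : grid d Z m) (r : 'rV['I_n]_d) i : nat := (g.1 ord0 i * n + r ord0 i)%N.
have un g r i : (u g r i < m'.+2)%N.
  have := ltn_ord (g.1 ord0 i); have := ltn_ord (r ord0 i); rewrite m'E /u.
  move: (nat_of_ord _) (nat_of_ord _) => a b; nia.
pose f (gr : grid d Z m * 'rV['I_n]_d) : grid d Z m' :=
  (\row_i inord (u gr.1 gr.2 i), gr.1.2).
have injf : injective f.
  move=> [[g z] r] [[g' z'] r'] /= ff; have /= zz := congr1 snd ff.
  have gg i : u (g, z) r i = u (g', z') r' i.
    have /rowP/(_ i) := congr1 fst ff; rewrite !mxE => /(congr1 val).
    by rewrite /= !inordK.
  have q i : (g ord0 i : nat) = g' ord0 i /\ (r ord0 i : nat) = r' ord0 i.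
    have := gg i; rewrite /u /= => E; split.
      by have := congr1 (divn^~ n) E; rewrite !divnMDl // !divn_small // !addn0.
    by have := congr1 (modn^~ n) E; rewrite !modnMDl !modn_small.
  by rewrite zz; congr (_, _, _); apply/rowP => i; apply: val_inj; have [] := q i.
exists m', (f @: finset.setX S [set: 'rV['I_n]_d]%SET); split=> //.
  move=> _ /imsetP[[[g z] r] grS ->]; move: grS; rewrite finset.in_setX => /andP[/= gS _].
  have nr0 : n%:R != 0 :> R by rewrite pnatr_eq0 -lt0n.
  have m2r0 : m.+2%:R != 0 :> R by rewrite pnatr_eq0.
  exists (\row_i ((u (g, z) r i)%:R / m'.+2%:R)), (\row_i (u (g, z) r i)%:Z).
  split=> [||i].
  - exists (\row_i ((u (g, z) r i)%:R / m'.+2%:R)), (\row_i (g ord0 i : nat)%:Z).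
    split=> //=; first by rewrite map_intr_val.
    move=> i; rewrite !mxE -pmulrn m'E natrM invfM mulrCA mulVKf //.
    rewrite ler_pdivlMr ?ler_pdivrMr ?ltr0n // mulrDl mul1r -!natrM -natrD !ler_nat.
    by rewrite /u leq_addr leq_add2l ltnW.
  - apply/rowP => i; rewrite !mxE -pmulrn Zp_nat; apply: val_inj.
    by rewrite /= inordK // modn_small.
  - by rewrite !mxE mulrC divfK ?pnatr_eq0 // -pmulrn subrr normr0.
rewrite /dens card_imset // cardsX cardsT card_mx mul1n card_ord m'E.
rewrite !natrM natrX exprMn_comm; last exact: mulrC.
rewrite [X in _ / X]mulrAC -mulf_div divff ?mulr1 //.
by rewrite expf_neq0 // pnatr_eq0 -lt0n.
Qed.

(** This lower bound on an outer measure comes from counting: [dens_le_haar] for the closed set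
    [cells S] at distance 0, on a refinement of the same density, with [e] arbitrary. *)
Lemma dens_le_haar_cells m (S : {set grid d Z m}) :
  ((dens S)%:E <= haar (cells S : set (@TZ R d Z)))%E.
Proof.
apply/lee_addgt0Pr => e e0; have [N NP] := dens_le_haar 0 (@closedTZ_cells R d Z m S) e0.
have [m' [S' [m'E S'S <-]]] := refine_cells S (ltn0Sn N).
by apply: NP => //; move: m'E; lia.
Qed.

End Density.

(** * Passage from closed sets to grid sets and back *)

Section Discretization.
Context {R : realType} {d : nat} {Z : finZmodType} {m : nat}.
Implicit Types (x y : 'rV[R]_d) (h : 'rV[int]_d) (K : set (@TZ R d Z)).
Implicit Types (S T : {set grid d Z m}).

Definition near_set K : {set grid d Z m} := [set g | `[< grid_near K 1 g >]]%SET.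

Lemma mem_near_set K g : grid_near K 1 g -> g \in near_set K.
Proof. by move=> Kg; rewrite inE; apply/asboolP. Qed.

Lemma near_setP K g : g \in near_set K -> grid_near K 1 g.
Proof. by rewrite inE => /asboolP. Qed.

Lemma sub_cells_near_set K : K `<=` cells (near_set K).
Proof.
move=> p; have [x [z ->]] := TZ_ex p => Kp.
exists x, (map_mx Num.floor (m.+2%:R *: x)); split=> //.
  apply/mem_near_set; exists x, (map_mx Num.floor (m.+2%:R *: x)); split=> // i.
  rewrite !mxE; have := floor_itv (m.+2%:R * x ord0 i); rewrite intrD => ?.
  by rewrite ler_norml; lra.
move=> i; rewrite !mxE; have := floor_itv (m.+2%:R * x ord0 i); rewrite intrD.
by move=> /andP[-> /ltW].
Qed.

(** Induction on [l]: by [cells_add], adding one more [B] to a union of cells adds one [near_set B]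
    to the corners. *)
Lemma cells_sumset_msumset S B l :
  sumset (cells S) (msumset l B) `<=` cells (sumset_iter S (near_set B) l).
Proof.
move=> _ [p [q [pS [qB ->]]]]; elim: l q qB => [q ->|l IH _ [q [b [qB [Bb ->]]]]] /=.
  have [x [z pE]] := TZ_ex p.
  by rewrite /tzzero pE tzadd_tproj !addr0 -pE.
by rewrite tzaddA; apply: cells_add (IH _ qB) Bb => g; exact: mem_near_set.
Qed.

(** A point of a cell is within [1/M] of its corner, and the corner within [1/M] of [K]; with
    [M = 2n] this totals [1/n]. *)
Lemma cells_near_thicken K S n : m.+2 = n.*2 -> S \subset near_set K ->
  cells S `<=` thicken K n.
Proof.
move=> mn /fintype.subsetP SK [_ z] [y [h [/= -> /SK/near_setP[x [h' [/= Kx hh' xh]]] yh]]].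
have [k hk] := grid_lift (m := m) h; have [k' hk'] := grid_lift (m := m) h'.
(* [h] and [h'] lift the same grid point; the integer vector [k' - k] brings [y] next to [x] in the
   cover. *)
exists (tproj x, z), (tproj (y + map_mx intr (k' - k) - x), 0).
split=> //; split; last first.
  by rewrite tzadd_tproj addrC addr0 -addrA (addrC (- x)) addrA addrK tproj_addz.
exists (y + map_mx intr (k' - k) - x); split=> // i.
have n0 : 0 < n%:R :> R by rewrite ltr0n; move: mn; case: (n).
rewrite !mxE intrB -(ler_pM2l n0) divff ?lt0r_neq0 // -[X in X * _]ger0_norm ?ler0n //.
rewrite -normrM; have := xh i; have := yh i.
have mR : m.+2%:R = n%:R * 2 :> R by rewrite mn -muln2 natrM.
rewrite hk hk' -hh' !rmorphD !rmorphM /= -!pmulrn mR !ler_norml.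
lra.
Qed.

Lemma cells_nonempty S : S != finset.set0 -> (cells S : set (@TZ R d Z)) !=set0.
Proof.
move=> /set0Pn[[g z] gS].
exists (tproj (\row_i ((g ord0 i : nat)%:R / m.+2%:R)), z).
exists (\row_i ((g ord0 i : nat)%:R / m.+2%:R)), (\row_i (g ord0 i : nat)%:Z).
split=> //=; first by rewrite map_intr_val.
by move=> i; rewrite !mxE mulrC divfK ?pnatr_eq0 // -pmulrn lexx lerDl ler01.
Qed.

Lemma dens_leM (c : R) S T : (dens S <= c * dens T) = (#|S|%:R <= c * #|T|%:R).
Proof.
rewrite /dens mulrA ler_pM2r // invr_gt0 mulr_gt0 ?exprn_gt0 // ltr0n.
by apply/card_gt0P; exists 0.
Qed.

End Discretization.

(** * The finite inequality transferred from the grid of mesh [1/(2n)] *)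

Unset Implicit Arguments.

Theorem theorem2p5 (R : realType) (d : nat) (Z : finZmodType) (alpha : R)
    (A B : set (@TZ R d Z)) :
  closedTZ A -> closedTZ B ->
  (0 < haar (sumset A B))%E ->
  (haar (sumset A B) <= alpha%:E * haar A)%E ->
  forall eps : R, 0 < eps ->
  exists N : nat, forall n : nat, (N <= n)%N -> (0 < n)%N ->
    exists A' : set (@TZ R d Z),
      [/\ A' `<=` thicken A n, A' !=set0, closedTZ A' &
        forall m : nat,
          (haar (sumset A' (msumset m B))
             <= ((1 + eps) ^+ m * alpha ^+ m)%:E * haar A')%E].
Proof.
move=> cA cB; have [s sE] : exists s, haar (sumset A B) = s%:E.
  by rewrite haarE; eexists.
have [a aE] : exists a, haar A = a%:E by rewrite haarE; eexists.
rewrite sE aE lte_fin -EFinM lee_fin => s0 s_le eps eps0.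
have a_ge0 : 0 <= a.
  rewrite -lee_fin -aE haarE lee_fin mulr_ge0 ?invr_ge0 // sumr_ge0 // => z _.
  by rewrite fine_ge0 // lebesgue_outer_ge0.
have alpha0 : 0 < alpha by nra.
have K0 : 0 <= (1 + eps) * alpha by rewrite mulr_ge0 ?addr_ge0 // ltW.
(* Sums of points of [At] and [Bt] are within [1 + 1] mesh units of [A + B]. The tolerance [eps * s]
   turns the bound into [(1 + eps) * s]. *)
have [N NP] := dens_le_haar (1 + 1) (closedTZ_sumset cA cB) (mulr_gt0 eps0 s0).
exists N.+1 => n Nn n0; pose m := n.-1.*2.
have mn : m.+2 = n.*2 by rewrite /m -doubleS prednK.
have Nm : (N <= m)%N by move: mn Nn; lia.
pose At : {set grid d Z m} := near_set A; pose Bt : {set grid d Z m} := near_set B.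
have aAt : a <= dens At.
  by rewrite -lee_fin -aE; apply: haar_le_dens; exact: sub_cells_near_set.
(* If [At] were empty, [A] would have measure 0, and [s <= alpha * a] would contradict [0 < s]. *)
have At0 : At != finset.set0.
  apply/eqP => AtE; move: aAt; rewrite AtE /dens cards0 mul0r => a_le0.
  by move: s_le; rewrite (@le_anti _ _ a 0) ?a_le0 // mulr0 leNgt s0.
(* In densities: [At + Bt] has at most [(1 + eps) * s <= (1 + eps) * alpha * a], and
   [a <= dens At]. *)
have ABt : #|addset At Bt|%:R <= (1 + eps) * alpha * #|At|%:R :> R.
  rewrite -dens_leM -lee_fin; apply: le_trans (NP _ _ Nm _) _.
    move=> _ /imset2P[g h /near_setP gA /near_setP hB ->].
    exact: grid_near_sumset.
  rewrite sE -EFinD lee_fin -[X in X + _]mul1r -mulrDl -mulrA ler_wpM2l //.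
    by rewrite addr_ge0 // ltW.
  by rewrite (le_trans s_le) // ler_wpM2l // ltW.
have [S [SA S0 SK]] := pluennecke At0 ABt.
exists (cells S); split.
- exact: cells_near_thicken.
- exact: cells_nonempty.
- exact: closedTZ_cells.
(* The chain is [haar (A' + lB) <= dens (S + l Bt) <= K ^ l * dens S <= K ^ l * haar A'] with
   [K = (1 + eps) * alpha]. *)
- move=> l; apply: le_trans (haar_le_dens (@cells_sumset_msumset _ _ _ _ S B l)) _.
  rewrite -exprMn; apply: le_trans (_ : (((1 + eps) * alpha) ^+ l * dens S)%:E <= _)%E.
    by rewrite lee_fin dens_leM.
  by rewrite EFinM lee_wpmul2l ?lee_fin ?exprn_ge0 // dens_le_haar_cells.
Qed.
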